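(* Consider the equation $$u_{tx}=(1-\partial_x^2)\sin(u),\qquad x\in\mathbb{R},\ t>0.$$ For any $c<-1$ and $n\in\mathbb{Z}$, there exists: (i) a smooth traveling-wave solution $u(x,t)=\varphi(x-ct)$ of this equation such that $$\lim_{x\to-\infty}\varphi(x)=2n\pi,\qquad\lim_{x\to\infty}\varphi(x)=2(n+1)\pi;$$ (ii) a smooth traveling-wave solution $u(x,t)=\varphi(x-ct)$ of this equation such that $$\lim_{x\to-\infty}\varphi(x)=2(n+1)\pi,\qquad\lim_{x\to\infty}\varphi(x)=2n\pi.$$
   Context: Here $\varphi:\mathbb{R}\to\mathbb{R}$ is real-valued and smooth means $C^\infty$. *)

(* Defs.v *)
From Stdlib Require Import Reals ZArith.
From Coquelicot Require Import Coquelicot.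
Open Scope R_scope.

Definition smooth (f : R -> R) : Prop :=
  forall (k : nat) (x : R), ex_derive_n f k x.

Definition Dx (u : R -> R -> R) : R -> R -> R :=
  fun x t => Derive (fun y => u y t) x.

Definition Dt (u : R -> R -> R) : R -> R -> R :=
  fun x t => Derive (fun s => u x s) t.

(** [Derive] is total, so the existence of every derivative that occurs in the
    equation is required explicitly. *)
Definition ex_Dx (u : R -> R -> R) (x t : R) : Prop :=
  ex_derive (fun y => u y t) x.

Definition ex_Dt (u : R -> R -> R) (x t : R) : Prop :=
  ex_derive (fun s => u x s) t.

Definition sin_of (u : R -> R -> R) : R -> R -> R := fun x t => sin (u x t).

(** [u_tx = (1 - d^2/dx^2) (sin u)], with arguments in the order [u x t]. *)
Definition is_solution (u : R -> R -> R) : Prop :=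
  forall x t : R, 0 < t ->
    ex_Dt u x t /\ ex_Dx (Dt u) x t /\
    ex_Dx (sin_of u) x t /\ ex_Dx (Dx (sin_of u)) x t /\
    Dx (Dt u) x t = sin_of u x t - Dx (Dx (sin_of u)) x t.

Definition traveling_wave (c : R) (phi : R -> R) : R -> R -> R :=
  fun x t => phi (x - c * t).

(* Main.v *)
(* With [k = -c > 1] the travelling-wave equation is
    [((k + cos phi) phi')' = sin phi].  Its energy integral, at the level of the
    equilibrium [0], reads
    [((k + cos phi) phi')^2 = 4 sin^2 (phi/2) (k + cos^2 (phi/2))].
    Substituting [phi = 4 atan (exp y)], so that [sin (phi/2) = sech y], turns the
    first-order equation into [y' = 1 / g y] with [g] bounded below by a positive
    constant; hence [y] is the inverse of a primitive of [g], a bijection of the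
    line.  Since [k > 1], [k + cos phi] never vanishes; the wave is smooth because the
    polynomials in [sin (phi/2)], [cos (phi/2)], [sqrt (k + cos^2 (phi/2))] and
    [1 / (k + cos phi)] are stable under differentiation. *)
Require Import Defs.
From Stdlib Require Import Reals ZArith Lra Ranalysis5.
From Coquelicot Require Import Coquelicot.
Open Scope R_scope.

(** * Function algebras closed under differentiation *)

Inductive generated_by (G : (R -> R) -> Prop) : (R -> R) -> Prop :=
| gen_base f : G f -> generated_by G f
| gen_const a : generated_by G (fun _ => a)
| gen_plus f g : generated_by G f -> generated_by G g ->
    generated_by G (fun x => f x + g x)
| gen_mult f g : generated_by G f -> generated_by G g ->
    generated_by G (fun x => f x * g x).

Definition closed_under_derivation (P Q : (R -> R) -> Prop) : Prop :=
  forall f, P f -> exists g, Q g /\ forall x, is_derive f x (g x).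

(** By linearity and the Leibniz rule, a derivation that sends the generators into the algebra they
    generate preserves the whole algebra. *)
Lemma generated_by_closed (G : (R -> R) -> Prop) :
  closed_under_derivation G (generated_by G) ->
  closed_under_derivation (generated_by G) (generated_by G).
Proof.
  intros HG f Hf.
  induction Hf as [f Hf|a|f g Hf [f' [Gf' Df]] Hg [g' [Gg' Dg]]
                  |f g Hf [f' [Gf' Df]] Hg [g' [Gg' Dg]]].
  - exact (HG f Hf).
  - exists (fun _ => 0); split; [apply gen_const|].
    intros x; apply (is_derive_const a x).
  - exists (fun x => f' x + g' x); split; [now apply gen_plus|].
    intros x; apply (is_derive_plus f g x _ _ (Df x) (Dg x)).
  - exists (fun x => f' x * g x + f x * g' x); split.
    + apply gen_plus; now apply gen_mult.
    + intros x; apply (is_derive_mult f g x _ _ (Df x) (Dg x)).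
      intros; apply Rmult_comm.
Qed.

(** By induction every iterated derivative coincides pointwise with a member of [P], and members of
    [P] are differentiable. *)
Lemma smooth_of_closed (P : (R -> R) -> Prop) :
  closed_under_derivation P P -> forall f, P f -> smooth f.
Proof.
  intros HP f Hf [|k] x; [exact I|]; simpl.
  assert (Hk : exists g, P g /\ forall y, Derive_n f k y = g y).
  { induction k as [|k [g [Pg Eg]]].
    - now exists f.
    - destruct (HP g Pg) as [g' [Pg' Dg]].
      exists g'; split; [assumption|]; intros y; simpl.
      rewrite (Derive_ext _ _ y Eg); now apply is_derive_unique. }
  destruct Hk as [g [Pg Eg]], (HP g Pg) as [g' [_ Dg]].
  apply (ex_derive_ext g); [now intros; rewrite Eg|].
  now exists (g' x).
Qed.

(** * Reduction to an ordinary differential equation *)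

(** Chain rule, with [p] and [q] playing phi' and phi''. Explicit derivatives deliver the existence
    clauses of [is_solution] together with the values. *)
Lemma traveling_wave_is_solution (c : R) (phi p q : R -> R) :
  (forall x, is_derive phi x (p x)) ->
  (forall x, is_derive p x (q x)) ->
  (forall x, - c * q x =
     sin (phi x) - (cos (phi x) * q x - sin (phi x) * p x ^ 2)) ->
  is_solution (traveling_wave c phi).
Proof.
  intros Dphi Dp Heq x t _.
  unfold ex_Dt, ex_Dx.
  assert (Ht : forall y, is_derive (fun s => traveling_wave c phi y s) t
                           (- c * p (y - c * t))).
  { intros y; unfold traveling_wave.
    apply (is_derive_comp phi (fun s => y - c * s) t _ (- c)); [apply Dphi|].
    auto_derive; [trivial|ring]. }
  assert (Htx : is_derive (fun y => Dt (traveling_wave c phi) y t) x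
                  (- c * q (x - c * t))).
  { apply (is_derive_ext (fun y => - c * p (y - c * t))).
    - intros y; symmetry; exact (is_derive_unique _ _ _ (Ht y)).
    - apply is_derive_scal.
      rewrite <- (Rmult_1_l (q (x - c * t))).
      apply (is_derive_comp p (fun y => y - c * t) x _ 1); [apply Dp|].
      auto_derive; [trivial|ring]. }
  assert (Hx : forall y, is_derive (fun z => sin_of (traveling_wave c phi) z t) y
                           (cos (phi (y - c * t)) * p (y - c * t))).
  { intros y; unfold sin_of, traveling_wave.
    auto_derive; [now exists (p (y - c * t))|].
    replace (Derive (fun z : R => phi z) (y + - (c * t))) with (p (y - c * t))
      by (symmetry; apply is_derive_unique, Dphi).
    unfold Rminus; ring. }
  assert (Hxx : is_derive (fun y => Defs.Dx (sin_of (traveling_wave c phi)) y t) x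
                  (cos (phi (x - c * t)) * q (x - c * t)
                   - sin (phi (x - c * t)) * p (x - c * t) ^ 2)).
  { apply (is_derive_ext (fun y => cos (phi (y - c * t)) * p (y - c * t))).
    - intros y; symmetry; exact (is_derive_unique _ _ _ (Hx y)).
    - auto_derive.
      + repeat split; [now exists (p (x - c * t))|now exists (q (x - c * t))].
      + replace (Derive (fun z : R => phi z) (x + - (c * t))) with (p (x - c * t))
      by (symmetry; apply is_derive_unique, Dphi).
        replace (Derive (fun z : R => p z) (x + - (c * t))) with (q (x - c * t))
      by (symmetry; apply is_derive_unique, Dp).
        unfold Rminus; ring. }
  repeat split.
  - eexists; apply Ht.
  - eexists; apply Htx.
  - eexists; apply Hx.
  - eexists; apply Hxx.
  - transitivity (- c * q (x - c * t)); [exact (is_derive_unique _ _ _ Htx)|].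
    rewrite Heq; apply (f_equal (Rminus _)); symmetry.
    exact (is_derive_unique _ _ _ Hxx).
Qed.

(** * Solving the autonomous equation by quadrature *)

(** Separation of variables: a primitive [X] of [g] grows at rate at least [m], hence is an
    increasing bijection of the line, and its inverse [Y] has derivative [1 / g(Y)]. *)
Lemma inverse_of_primitive (g : R -> R) (m : R) :
  0 < m -> (forall y, m <= g y) -> (forall y, continuous g y) ->
  exists Y : R -> R, (forall x, is_derive Y x (/ g (Y x))) /\
    is_lim Y m_infty m_infty /\ is_lim Y p_infty p_infty.
Proof.
  intros Hm Hg Cg.
  set (X := fun y => RInt g 0 y).
  assert (DX : forall y, is_derive X y (g y)).
  { intros y; apply (is_derive_RInt g X 0 y); [|apply Cg].
    apply filter_forall; intros b; apply (@RInt_correct R_CompleteNormedModule).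
    apply (@ex_RInt_continuous R_CompleteNormedModule); intros; apply Cg. }
  assert (CX : continuity X).
  { intros y; apply continuity_pt_filterlim, (@ex_derive_continuous R_AbsRing).
    now exists (g y). }
  assert (Hgrow : forall a b, a <= b -> m * (b - a) <= X b - X a).
  { intros a b Hab.
    destruct (MVT_gen X a b g) as [z [_ Ez]];
      [intros; apply DX|intros; apply CX|].
    rewrite Ez; apply Rmult_le_compat_r; [lra|apply Hg]. }
  assert (X0 : X 0 = 0) by exact (RInt_point 0 g).
  assert (Hsurj : forall x, {y | X y = x}).
  { intros x.
    (* Growth from [X 0 = 0] gives [X (- b) <= - Rabs x] and [Rabs x <= X b], so [x] lies between
       these two values. *)
    set (b := Rabs x / m).
    assert (Hb : 0 <= b).
    { apply Rmult_le_pos; [apply Rabs_pos|].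
      apply Rlt_le, Rinv_0_lt_compat, Hm. }
    assert (Eb : m * b = Rabs x) by (unfold b; field; lra).
    pose proof (Hgrow 0 b Hb); pose proof (Hgrow (- b) 0 ltac:(lra)).
    destruct (IVT_gen X (- b) b x CX) as [y [_ Ey]]; [|now exists y].
    pose proof (Rle_abs x); pose proof (Rle_abs (- x)).
    rewrite Rabs_Ropp in *.
    rewrite Rmin_left, Rmax_right by nra; nra. }
  set (Y := fun x => proj1_sig (Hsurj x)).
  assert (XY : forall x, X (Y x) = x) by (intros x; apply (proj2_sig (Hsurj x))).
  (* Otherwise [Y b <= a], and monotonicity of [X] would give [b = X (Y b) <= X a]. *)
  assert (Hlt : forall a b, X a < b -> a < Y b).
  { intros a b H; apply Rnot_le_lt; intros H'.
    specialize (Hgrow _ _ H'); rewrite XY in Hgrow; nra. }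
  assert (Hgt : forall a b, b < X a -> Y b < a).
  { intros a b H; apply Rnot_le_lt; intros H'.
    specialize (Hgrow _ _ H'); rewrite XY in Hgrow; nra. }
  assert (CY : forall x, continuity_pt Y x).
  { intros x; apply continuity_pt_locally; intros eps.
    pose proof (cond_pos eps) as He.
    pose proof (Hgrow (Y x) (Y x + eps) ltac:(lra)) as H1.
    pose proof (Hgrow (Y x - eps) (Y x) ltac:(lra)) as H2.
    rewrite XY in H1, H2.
    (* The growth rate [m] makes [Y] Lipschitz with constant [1 / m], so [m * eps] serves as
       delta. *)
    assert (Hd : 0 < m * eps) by nra.
    exists (mkposreal _ Hd); intros z Hz.
    change (Rabs (z - x) < m * eps) in Hz.
    apply Rabs_def2 in Hz; apply Rabs_def1.
    - enough (Y z < Y x + eps) by lra; apply Hgt; lra.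
    - enough (Y x - eps < Y z) by lra; apply Hlt; lra. }
  exists Y; split; [|split].
  - intros x; apply is_derive_Reals.
    (* [Prf] carries the value [g a] itself, so that [simpl] reduces the [derive_pt] of the inverse
       function theorem to [g (Y x)]. *)
    pose (Prf := fun a (_ : Y (x - 1) <= a <= Y (x + 1)) =>
            exist (fun l => derivable_pt_lim X a l) (g a)
              (proj1 (is_derive_Reals X a (g a)) (DX a))).
    assert (Hin : Y (x - 1) <= Y x <= Y (x + 1)).
    { split; apply Rlt_le; [apply Hgt|apply Hlt]; rewrite XY; lra. }
    pose proof (derivable_pt_lim_recip_interv X Y (x - 1) (x + 1) x Prf (CY x)
      ltac:(lra) ltac:(lra) Hin (fun z _ => XY z)) as H.
    simpl in H; unfold Rdiv in H; rewrite Rmult_1_l in H; apply H.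
    pose proof (Hg (Y x)); lra.
  (* Any [x < X M] satisfies [Y x < M]; the other end is symmetric. *)
  - intros P [M HM]; exists (X M); intros x Hx; apply HM, Hgt, Hx.
  - intros P [M HM]; exists (X M); intros x Hx; apply HM, Hlt, Hx.
Qed.

(** * The angle substitution *)

(* [gd] plus [PI / 2], where [gd] is the Gudermannian; half of the wave angle. *)
Definition half_angle (y : R) : R := 2 * atan (exp y).

(** Both the derivative and the sine equal [2 exp y / (1 + exp (2 y))], that is, sech y. *)
Lemma is_derive_half_angle (y : R) :
  is_derive half_angle y (sin (half_angle y)).
Proof.
  unfold half_angle.
  assert (H : 0 < 1 + (exp y)²) by (pose proof (Rle_0_sqr (exp y)); lra).
  rewrite sin_2a, sin_atan, cos_atan.
  auto_derive; [trivial|].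
  pose proof (sqrt_lt_R0 _ H) as Hr.
  pose proof (sqrt_sqrt _ (Rlt_le _ _ H)) as Er.
  set (r := sqrt _) in *; clearbody r; unfold Rsqr in *.
  rewrite (Rmult_1_r (exp y)), <- Er; field; lra.
Qed.

Lemma is_lim_half_angle_m : is_lim half_angle m_infty 0.
Proof.
  unfold half_angle.
  replace (Finite 0) with (Finite ((fun z => 2 * atan z) 0))
    by (simpl; rewrite atan_0; f_equal; ring).
  apply (is_lim_comp_continuous exp (fun z => 2 * atan z)).
  - apply is_lim_exp_m.
  - apply (@ex_derive_continuous R_AbsRing); auto_derive; trivial.
Qed.

Lemma half_angle_opp (y : R) : half_angle (- y) = PI - half_angle y.
Proof.
  unfold half_angle; rewrite exp_Ropp, atan_inv by apply exp_pos; field.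
Qed.

Lemma is_lim_half_angle_p : is_lim half_angle p_infty PI.
Proof.
  apply (is_lim_ext (fun y => PI - half_angle (- y))).
  { intros y; rewrite half_angle_opp; ring. }
  replace (Finite PI) with (Finite ((fun z => PI - z) 0)) by (simpl; f_equal; ring).
  apply (is_lim_comp_continuous (fun y => half_angle (- y)) (fun z => PI - z)).
  - apply (is_lim_comp half_angle Ropp p_infty 0 m_infty).
    + apply is_lim_half_angle_m.
    + apply (is_lim_opp (fun y => y) p_infty p_infty), is_lim_id.
    + now exists 0.
  - apply (@ex_derive_continuous R_AbsRing); auto_derive; trivial.
Qed.

(** Take [theta] to be [half_angle] composed with [Y], where [Y' = 1 / g(Y)]. The factor
    [sin theta], which vanishes at the equilibria, comes from [half_angle]; what remains is [1 / g],
    with [g] bounded below. *)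
Lemma half_wave_exists (k : R) (hk : 1 < k) :
  exists theta : R -> R,
    (forall x, is_derive theta x
       (sin (theta x) *
        (sqrt (k + cos (theta x) ^ 2) * / (k - 1 + 2 * cos (theta x) ^ 2)))) /\
    is_lim theta m_infty 0 /\ is_lim theta p_infty PI.
Proof.
  set (g := fun y => (k - 1 + 2 * cos (half_angle y) ^ 2)
                     / sqrt (k + cos (half_angle y) ^ 2)).
  assert (HS : forall y, 0 < k + cos (half_angle y) ^ 2).
  { intros y; pose proof (pow2_ge_0 (cos (half_angle y))); lra. }
  (* Lower bound for [g]: the numerator is least at [cos ^ 2 = 0], the denominator greatest at
     [cos ^ 2 = 1]. *)
  destruct (inverse_of_primitive g ((k - 1) / sqrt (k + 1))) as [Y [DY [LYm LYp]]].
  - apply Rdiv_lt_0_compat; [lra|apply sqrt_lt_R0; lra].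
  - intros y; unfold g, Rdiv.
    pose proof (pow2_ge_0 (cos (half_angle y))).
    apply Rmult_le_compat; [lra| |lra|].
    + apply Rlt_le, Rinv_0_lt_compat, sqrt_lt_R0; lra.
    + apply Rinv_le_contravar; [apply sqrt_lt_R0, HS|].
      apply sqrt_le_1_alt.
      pose proof (COS_bound (half_angle y)); nra.
  - intros y; apply (@ex_derive_continuous R_AbsRing); unfold g.
    assert (Dh : ex_derive half_angle y)
      by (eexists; apply is_derive_half_angle).
    auto_derive.
    specialize (HS y); simpl in HS.
    repeat split; trivial.
    apply Rgt_not_eq, sqrt_lt_R0, HS.
  - exists (fun x => half_angle (Y x)); split; [|split].
    + intros x.
      evar_last.
      * apply (is_derive_comp half_angle Y x);
          [apply is_derive_half_angle|apply DY].
      * pose proof (sqrt_lt_R0 _ (HS (Y x))).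
        pose proof (pow2_ge_0 (cos (half_angle (Y x)))).
        unfold g; change scal with Rmult; field; lra.
    + apply (is_lim_comp half_angle Y m_infty 0 m_infty);
        [apply is_lim_half_angle_m|exact LYm|now exists 0].
    + apply (is_lim_comp half_angle Y p_infty PI p_infty);
        [apply is_lim_half_angle_p|exact LYp|now exists 0].
Qed.


(** * Smoothness of the wave and the wave equation *)

(** The wave is [a + sigma * (2 * theta)]: [a] is its starting equilibrium and [sigma] its
    orientation. It is listed as a generator so that smoothness applies to it directly. *)
Inductive half_wave_generator (k a sigma : R) (theta : R -> R) : (R -> R) -> Prop :=
| gen_wave : half_wave_generator k a sigma theta (fun x => a + sigma * (2 * theta x))
| gen_sin : half_wave_generator k a sigma theta (fun x => sin (theta x))
| gen_cos : half_wave_generator k a sigma theta (fun x => cos (theta x))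
| gen_sqrt : half_wave_generator k a sigma theta
    (fun x => sqrt (k + cos (theta x) ^ 2))
| gen_inv : half_wave_generator k a sigma theta
    (fun x => / (k - 1 + 2 * cos (theta x) ^ 2)).

Section HalfWave.

Variables (k a sigma : R) (theta : R -> R).
Hypothesis hk : 1 < k.

(** By the double angle formula, [D] is the reciprocal of [k + cos (2 * theta x)]. *)
Let s x := sin (theta x).
Let C x := cos (theta x).
Let S x := sqrt (k + cos (theta x) ^ 2).
Let D x := / (k - 1 + 2 * cos (theta x) ^ 2).

Hypothesis Dtheta : forall x, is_derive theta x (s x * (S x * D x)).

Let ex_theta x : ex_derive theta x.
Proof. eexists; apply Dtheta. Qed.

Let Derive_theta x : Derive (fun y => theta y) x = s x * (S x * D x).
Proof. apply is_derive_unique, Dtheta. Qed.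

Let S2_pos x : 0 < k + cos (theta x) ^ 2.
Proof. pose proof (pow2_ge_0 (cos (theta x))); lra. Qed.

Let S_pos x : 0 < S x.
Proof. apply sqrt_lt_R0, S2_pos. Qed.

Let S2 x : S x * S x = k + C x ^ 2.
Proof. apply sqrt_sqrt, Rlt_le, S2_pos. Qed.

Let den_pos x : 0 < k - 1 + 2 * C x ^ 2.
Proof. pose proof (pow2_ge_0 (C x)); lra. Qed.

Let s2 x : s x ^ 2 = 1 - C x ^ 2.
Proof. pose proof (sin2 (theta x)); unfold Rsqr, s, C in *; lra. Qed.

Lemma half_wave_is_derive x : is_derive (fun y => a + sigma * (2 * theta y)) x
  (2 * sigma * (s x * (S x * D x))).
Proof.
  auto_derive; [apply ex_theta|]; rewrite Derive_theta; ring.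
Qed.

(** Here and below, derivatives are products of constants and generators, with [-1] for signs and no
    powers, so that [gen_mult] and [gen_const] recognise them syntactically. *)
Lemma half_wave_is_derive_sin x : is_derive s x (C x * (s x * (S x * D x))).
Proof.
  unfold s at 1; auto_derive; [apply ex_theta|]; rewrite Derive_theta.
  unfold C; ring.
Qed.

Lemma half_wave_is_derive_cos x : is_derive C x (-1 * (s x * (s x * (S x * D x)))).
Proof.
  unfold C at 1; auto_derive; [apply ex_theta|]; rewrite Derive_theta.
  unfold s; ring.
Qed.

(* The factor [S] of [theta'] cancels the [1 / S] coming from the square root. *)
Lemma half_wave_is_derive_sqrt x :
  is_derive S x (-1 * (C x * (s x * (s x * D x)))).
Proof.
  unfold S at 1.
  auto_derive.
  - split; [apply ex_theta|split; [apply S2_pos|trivial]].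
  - rewrite Derive_theta.
    change (sqrt (k + cos (theta x) * (cos (theta x) * 1))) with (S x).
    fold (s x) (C x).
    pose proof (S_pos x); field; lra.
Qed.

Lemma half_wave_is_derive_inv x :
  is_derive D x (4 * (C x * (s x * (s x * (S x * (D x * (D x * D x))))))).
Proof.
  pose proof (den_pos x) as H; unfold C in H.
  unfold D at 1.
  auto_derive.
  - split; [apply ex_theta|split; [|trivial]].
    simpl in H; lra.
  - rewrite Derive_theta.
    unfold C, D, s; field; lra.
Qed.

Lemma half_wave_generator_closed :
  closed_under_derivation (half_wave_generator k a sigma theta)
    (generated_by (half_wave_generator k a sigma theta)).
Proof.
  assert (Gs : generated_by (half_wave_generator k a sigma theta) s)
    by apply gen_base, gen_sin.
  assert (GC : generated_by (half_wave_generator k a sigma theta) C)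
    by apply gen_base, gen_cos.
  assert (GS : generated_by (half_wave_generator k a sigma theta) S)
    by apply gen_base, gen_sqrt.
  assert (GD : generated_by (half_wave_generator k a sigma theta) D)
    by apply gen_base, gen_inv.
  intros f [];
    [ eexists; split; [|apply half_wave_is_derive]
    | eexists; split; [|apply half_wave_is_derive_sin]
    | eexists; split; [|apply half_wave_is_derive_cos]
    | eexists; split; [|apply half_wave_is_derive_sqrt]
    | eexists; split; [|apply half_wave_is_derive_inv] ];
    repeat first [assumption | apply gen_mult | apply gen_const].
Qed.

Lemma half_wave_smooth : smooth (fun x => a + sigma * (2 * theta x)).
Proof.
  apply (smooth_of_closed (generated_by (half_wave_generator k a sigma theta))).
  - apply generated_by_closed, half_wave_generator_closed.
  - apply gen_base, gen_wave.
Qed.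

Hypotheses (cos_a : cos a = 1) (sin_a : sin a = 0) (sigma_pm1 : sigma = 1 \/ sigma = -1).

Let sin_wave x : sin (a + sigma * (2 * theta x)) = 2 * sigma * (s x * C x).
Proof.
  rewrite sin_plus, cos_a, sin_a; unfold s, C.
  destruct sigma_pm1 as [-> | ->].
  - rewrite (Rmult_1_l (2 * theta x)), sin_2a; ring.
  - replace (-1 * (2 * theta x)) with (- (2 * theta x)) by ring.
    rewrite sin_neg, sin_2a; ring.
Qed.

Let cos_wave x : cos (a + sigma * (2 * theta x)) = 2 * C x ^ 2 - 1.
Proof.
  rewrite cos_plus, cos_a, sin_a; unfold C.
  destruct sigma_pm1 as [-> | ->].
  - rewrite (Rmult_1_l (2 * theta x)), cos_2a_cos; ring.
  - replace (-1 * (2 * theta x)) with (- (2 * theta x)) by ring.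
    rewrite cos_neg, cos_2a_cos; ring.
Qed.

Lemma half_wave_is_solution :
  is_solution (traveling_wave (- k) (fun x => a + sigma * (2 * theta x))).
Proof.
  set (p := fun x => 2 * sigma * (s x * (S x * D x))).
  (* Product rule applied to [s * S * D] with the three derivatives above, after factoring out
     [s * C * D ^ 2]. *)
  set (q := fun x => 2 * sigma * (s x * C x * D x ^ 2
              * (S x ^ 2 - s x ^ 2 + 4 * s x ^ 2 * S x ^ 2 * D x))).
  apply (traveling_wave_is_solution _ _ p q).
  - apply half_wave_is_derive.
  - intros x; unfold p.
    pose proof (half_wave_is_derive_sin x) as Ds.
    pose proof (half_wave_is_derive_sqrt x) as DS.
    pose proof (half_wave_is_derive_inv x) as DD.
    auto_derive.
    + repeat split; eexists; eassumption.
    + apply is_derive_unique in Ds, DS, DD.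
      change (Derive (fun y : R => s y) x) with (Derive s x); rewrite Ds.
      change (Derive (fun y : R => S y) x) with (Derive S x); rewrite DS.
      change (Derive (fun y : R => D y) x) with (Derive D x); rewrite DD.
      unfold q; ring.
  - intros x; rewrite sin_wave, cos_wave; unfold p, q.
    assert (HD : D x = / (k - 1 + 2 * C x ^ 2)) by reflexivity.
    assert (HS : S x ^ 2 = k + C x ^ 2) by (rewrite <- S2; ring).
    assert (Hsig : sigma ^ 2 = 1) by (destruct sigma_pm1 as [-> | ->]; ring).
    replace ((2 * sigma * (s x * (S x * D x))) ^ 2)
      with (4 * sigma ^ 2 * s x ^ 2 * S x ^ 2 * D x ^ 2) by ring.
    (* With [S ^ 2], [s ^ 2] and [D] expressed through [C], the equation is a rational identity in
       [k] and [C], up to the common factor [sigma * s * C]. *)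
    rewrite Hsig, HS, s2, HD.
    pose proof (den_pos x); field; lra.
Qed.

End HalfWave.

(** * Kinks and antikinks between consecutive equilibria *)

Lemma cos_2IZR_PI (j : Z) : cos (2 * IZR j * PI) = 1.
Proof.
  rewrite Rmult_assoc, cos_2a_sin.
  rewrite (sin_eq_0_1 (IZR j * PI)) by now exists j.
  ring.
Qed.

Lemma sin_2IZR_PI (j : Z) : sin (2 * IZR j * PI) = 0.
Proof.
  apply sin_eq_0_1; exists (2 * j)%Z; now rewrite mult_IZR.
Qed.

(** Since [theta] runs from 0 to [PI], [sigma = 1] gives a wave climbing by [2 * PI] and
    [sigma = -1] one descending by as much. *)
Lemma kink_exists (c : R) (hc : c < -1) (j : Z) (sigma : R) :
  sigma = 1 \/ sigma = -1 ->
  exists phi : R -> R,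
    smooth phi /\ is_solution (traveling_wave c phi) /\
    is_lim phi m_infty (2 * IZR j * PI) /\
    is_lim phi p_infty (2 * IZR j * PI + sigma * (2 * PI)).
Proof.
  intros Hsigma.
  destruct (half_wave_exists (- c)) as [theta [Dtheta [Lm Lp]]]; [lra|].
  set (aff := fun z => 2 * IZR j * PI + sigma * (2 * z)).
  assert (Caff : forall z, continuous aff z).
  { intros z; apply (@ex_derive_continuous R_AbsRing); unfold aff.
    auto_derive; trivial. }
  exists (fun x => 2 * IZR j * PI + sigma * (2 * theta x)).
  split; [|split; [|split]].
  - apply (half_wave_smooth (- c)); [lra|exact Dtheta].
  - rewrite <- (Ropp_involutive c).
    apply half_wave_is_solution;
      [lra|exact Dtheta|apply cos_2IZR_PI|apply sin_2IZR_PI|exact Hsigma].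
  - replace (Finite (2 * IZR j * PI)) with (Finite (aff 0))
      by (unfold aff; f_equal; ring).
    now apply (is_lim_comp_continuous theta aff).
  - now apply (is_lim_comp_continuous theta aff).
Qed.

Theorem proposition7p1 (c : R) (n : Z) (hc : c < -1) :
  (exists phi : R -> R,
      smooth phi /\ is_solution (traveling_wave c phi) /\
      is_lim phi m_infty (Finite (2 * IZR n * PI)) /\
      is_lim phi p_infty (Finite (2 * IZR (n + 1) * PI))) /\
  (exists phi : R -> R,
      smooth phi /\ is_solution (traveling_wave c phi) /\
      is_lim phi m_infty (Finite (2 * IZR (n + 1) * PI)) /\
      is_lim phi p_infty (Finite (2 * IZR n * PI))).
Proof.
  split.
  - replace (2 * IZR (n + 1) * PI) with (2 * IZR n * PI + 1 * (2 * PI))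
      by (rewrite plus_IZR; ring).
    apply (kink_exists c hc n 1); now left.
  (* The antikink starts from the upper equilibrium, hence the index [n + 1]. *)
  - replace (2 * IZR n * PI) with (2 * IZR (n + 1) * PI + -1 * (2 * PI))
      by (rewrite plus_IZR; ring).
    apply (kink_exists c hc (n + 1) (-1)); now right.
Qed.
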